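(* Let $1\le s\le d$. For any $v,\tilde v\in\mathbb{V}(s,d)$ with the same support, any positive definite matrix $\Sigma\in\mathbb{R}^{d\times d}$, and any real symmetric matrix $M\in\mathbb{R}^{d\times d}$, $$\big||v_\Sigma^{\top}Mv_\Sigma|-|\tilde v_\Sigma^{\top}M\tilde v_\Sigma|\big|\le2\gamma_s\,\|v-\tilde v\|_2\sup_{u\in\mathbb{V}(s,d)}|u_\Sigma^{\top}Mu_\Sigma|,$$ where $\gamma_s=\gamma_s(\Sigma)$.
   Context: $\mathbb{V}(s,d)=\{v\in\mathbb{R}^d:\|v\|_2=1,\ \|v\|_0\le s\}$, with $\|v\|_0$ the number of non-zero entries of $v$; the support of $v$ is the set of indices of its non-zero entries. For $v\ne0$ and $\Sigma$ positive definite, $\|v\|_\Sigma=(v^{\top}\Sigma v)^{1/2}$ and $v_\Sigma=v/\|v\|_\Sigma$. $\gamma_s(\Sigma)=\sqrt{\lambda_{\max,s}(\Sigma)/\lambda_{\min,s}(\Sigma)}$, with $\lambda_{\max,s}(\Sigma)=\sup_{v\in\mathbb{V}(s,d)}v^{\top}\Sigma v$ and $\lambda_{\min,s}(\Sigma)=\inf_{v\in\mathbb{V}(s,d)}v^{\top}\Sigma v$. *)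

(* Defs.v *)
From mathcomp Require Import all_boot all_order all_algebra.
From mathcomp Require Import classical_sets reals.

Set Implicit Arguments.
Unset Strict Implicit.
Unset Printing Implicit Defensive.

Import Order.TTheory GRing.Theory Num.Theory.
Local Open Scope ring_scope.

Section Definitions.
Variables (R : realType) (d : nat).
Implicit Types (A Sigma : 'M[R]_d) (v : 'cV[R]_d).

Definition supp v : {set 'I_d} := [set i | v i 0 != 0]%SET.

Definition norm0 v : nat := #|supp v|.

(* The norm that MathComp-Analysis puts on matrices is the max-norm, hence an
   explicit Euclidean norm. *)
Definition norm2 v : R := Num.sqrt (\sum_i v i 0 ^+ 2).

Definition sparse_sphere (s : nat) : set 'cV[R]_d :=
  [set v | norm2 v = 1 /\ (norm0 v <= s)%N]%classic.

Definition qform A v : R := (v^T *m A *m v) 0 0.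

Definition posdefmx A : Prop :=
  A \is symmetricmx /\ forall v, v != 0 -> 0 < qform A v.

Definition normS Sigma v : R := Num.sqrt (qform Sigma v).

Definition normalizeS Sigma v : 'cV[R]_d := (normS Sigma v)^-1 *: v.

Definition lambda_max (s : nat) Sigma : R :=
  sup [set qform Sigma v | v in sparse_sphere s]%classic.

Definition lambda_min (s : nat) Sigma : R :=
  inf [set qform Sigma v | v in sparse_sphere s]%classic.

Definition gamma (s : nat) Sigma : R :=
  Num.sqrt (lambda_max s Sigma / lambda_min s Sigma).

End Definitions.

(* Main.v *)
(** Write [Q] for [qform Sigma], [B] for [qform M] and [S] for the supremum of
    [|B u| / Q u] over the sparse sphere.  Vectors supported in the common
    support of [v] and [w] satisfy [|B u| <= S Q u], so polarization yields
    [B(x, y)^2 <= S^2 Q x Q y] on them.  With [a], [b] the [Sigma]-normalizations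
    of [v], [w], this applies to [B a - B b = B(a - b, a + b)], while
    [Q (a - b) Q (a + b) = 4 (1 - Q(v, w)^2 / (Q v Q w)) <= 4 Q (v - w) / Q w],
    the inequality being [(Q v - Q(v, w))^2 >= 0].  Finally
    [Q (v - w) <= lambda_max |v - w|^2] and [Q w >= lambda_min]. *)
Require Import Defs.
From mathcomp Require Import all_boot all_order all_algebra.
From mathcomp Require Import classical_sets reals.
From mathcomp Require Import ring lra.

Import Order.TTheory GRing.Theory Num.Theory.
Local Open Scope ring_scope.

(** For [q > 0] the hypothesis is sharpest at [t = b / q]. For [q = 0] the term linear in [t] is
    bounded above, which forces [b = 0]. *)
Lemma discriminant_le (F : realFieldType) (p q b : F) :
  0 <= q -> (forall t, 2 * t * b <= p + t ^+ 2 * q) -> b ^+ 2 <= p * q.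
Proof.
rewrite le_eqVlt => /predU1P[<- h|q0 h].
  have [->|b0] := eqVneq b 0; first by rewrite expr0n mulr0.
  (* This [t] makes the left-hand side [p + 1], beyond the bound [p]. *)
  have := h ((p + 1) / (2 * b)).
  have -> : 2 * ((p + 1) / (2 * b)) * b = p + 1 by field.
  by rewrite mulr0 addr0; lra.
have := h (b / q).
have -> : 2 * (b / q) * b = 2 * b ^+ 2 / q by field; rewrite gt_eqF.
have -> : (b / q) ^+ 2 * q = b ^+ 2 / q by field; rewrite gt_eqF.
have -> : 2 * b ^+ 2 / q = b ^+ 2 / q + b ^+ 2 / q by ring.
by rewrite lerD2r ler_pdivrMr.
Qed.

(** * Bilinear and quadratic forms of a matrix *)

Section BilinearForm.
Context {R : realType} {d : nat}.
Implicit Types (A Sigma : 'M[R]_d) (x y v w : 'cV[R]_d).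

Definition bform A x y : R := (x^T *m A *m y) 0 0.

Lemma qformE A x : qform A x = bform A x x.
Proof. by []. Qed.

Lemma bformDl A x y z : bform A (x + y) z = bform A x z + bform A y z.
Proof. by rewrite /bform linearD /= !mulmxDl mxE. Qed.

Lemma bformDr A x y z : bform A z (x + y) = bform A z x + bform A z y.
Proof. by rewrite /bform mulmxDr mxE. Qed.

Lemma bformZl A c x y : bform A (c *: x) y = c * bform A x y.
Proof. by rewrite /bform linearZ /= -!scalemxAl mxE. Qed.

Lemma bformZr A c x y : bform A x (c *: y) = c * bform A x y.
Proof. by rewrite /bform -!scalemxAr mxE. Qed.

Lemma bformC A x y : A \is symmetricmx -> bform A x y = bform A y x.
Proof.
move=> /is_hermitianmxP; rewrite expr0 scale1r map_mx_id// => AT.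
transitivity ((x^T *m A *m y)^T 0 0); first by rewrite [RHS]mxE.
by rewrite !trmx_mul trmxK -AT mulmxA.
Qed.

Lemma qformZ A c x : qform A (c *: x) = c ^+ 2 * qform A x.
Proof. by rewrite !qformE bformZl bformZr mulrA. Qed.

Lemma qform0 A : qform A 0 = 0.
Proof. by rewrite /qform mulmx0 mxE. Qed.

Lemma qform_lin A x y (a b : R) : A \is symmetricmx ->
  qform A (a *: x + b *: y)
  = a ^+ 2 * qform A x + 2 * a * b * bform A x y + b ^+ 2 * qform A y.
Proof.
move=> sA; rewrite !qformE !(bformDl, bformDr, bformZl, bformZr) (bformC A y x sA); ring.
Qed.

Lemma qform_subr A x y : A \is symmetricmx ->
  qform A x - qform A y = bform A (x - y) (x + y).
Proof.
move=> sA; rewrite -(scaleN1r y) !qformE !(bformDl, bformDr, bformZl).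
by rewrite (bformC A y x sA); ring.
Qed.

Lemma posdef_ge0 Sigma x : posdefmx Sigma -> 0 <= qform Sigma x.
Proof.
move=> [_ pS]; have [->|/pS/ltW//] := eqVneq x 0.
by rewrite qform0.
Qed.

Lemma bform_sqr_le Sigma x y : posdefmx Sigma ->
  bform Sigma x y ^+ 2 <= qform Sigma x * qform Sigma y.
Proof.
move=> pS; apply: discriminant_le => [|t]; first exact: posdef_ge0.
have := posdef_ge0 Sigma (1 *: x + (- t) *: y) pS.
rewrite qform_lin; last by case: pS.
by lra.
Qed.

(** A nonzero row of the left kernel would, once transposed, be a nonzero vector with vanishing
    quadratic form. *)
Lemma posdef_unit Sigma : posdefmx Sigma -> Sigma \in unitmx.
Proof.
move=> [_ pS]; rewrite -row_free_unit -kermx_eq0.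
apply/eqP/row_matrixP => i; rewrite row0; apply/eqP/negPn/negP => n0.
have /pS : (row i (kermx Sigma))^T != 0 by rewrite -trmx0 (inj_eq trmx_inj).
by rewrite /qform trmxK -row_mul mulmx_ker row0 mul0mx mxE ltxx.
Qed.

(** * Euclidean norm and sparsity *)

Lemma norm2_ge0 x : 0 <= norm2 x. Proof. exact: sqrtr_ge0. Qed.

Lemma sqr_norm2 x : norm2 x ^+ 2 = \sum_i x i 0 ^+ 2.
Proof. by rewrite sqr_sqrtr// sumr_ge0// => i _; rewrite sqr_ge0. Qed.

Lemma norm2_eq0 x : (norm2 x == 0) = (x == 0).
Proof.
rewrite -sqrf_eq0 sqr_norm2.
rewrite psumr_eq0; last by move=> i _; rewrite sqr_ge0.
apply/allP/eqP => [h|-> i _]; last by rewrite mxE expr0n eqxx.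
apply/matrixP => i j; rewrite ord1 mxE; apply/eqP.
by have := h i (mem_index_enum _); rewrite expf_eq0.
Qed.

Lemma norm2Z c x : norm2 (c *: x) = `|c| * norm2 x.
Proof.
rewrite /norm2 -sqrtr_sqr -sqrtrM ?sqr_ge0//; congr Num.sqrt.
by rewrite mulr_sumr; apply: eq_bigr => i _; rewrite mxE exprMn.
Qed.

(* Cauchy-Schwarz for [Sigma] applied to [x i = Sigma (Sigma^-1 e_i, x)]. *)
Lemma norm2_le_qform Sigma : posdefmx Sigma ->
  exists2 c, 0 <= c & forall x, norm2 x ^+ 2 <= c * qform Sigma x.
Proof.
move=> pS; have uS := posdef_unit Sigma pS.
pose e (i : 'I_d) : 'cV[R]_d := invmx Sigma *m delta_mx i 0.
exists (\sum_i qform Sigma (e i)); first by rewrite sumr_ge0// => i _; apply: posdef_ge0.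
move=> x; rewrite sqr_norm2 mulr_suml; apply: ler_sum => i _.
suff -> : x i 0 = bform Sigma (e i) x by exact: bform_sqr_le.
rewrite bformC; last by case: pS.
rewrite /bform /e mulmxA mulmxK// -colE.
by rewrite !mxE.
Qed.

(** Coordinates of a unit vector have modulus at most 1. The crude bound serves to show that the
    sets under [sup] are bounded above, so that each [sup] is a genuine least upper bound. *)
Lemma qform_le_sum A x : norm2 x = 1 ->
  `|qform A x| <= \sum_i \sum_j `|A j i|.
Proof.
move=> x1.
have le1 i : `|x i 0| <= 1.
  rewrite -[leRHS]x1 -sqrtr_sqr ler_wsqrtr// (bigD1 i)//= lerDl.
  by rewrite sumr_ge0// => j _; rewrite sqr_ge0.
rewrite /qform mxE (le_trans (ler_norm_sum _ _ _))//; apply: ler_sum => i _.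
rewrite mxE normrM (le_trans (ler_piMr _ (le1 i)))//.
rewrite (le_trans (ler_norm_sum _ _ _))//; apply: ler_sum => j _.
by rewrite mxE normrM ler_piMl.
Qed.

Lemma normalize_sparse s x : x != 0 -> (norm0 x <= s)%N ->
  sparse_sphere s ((norm2 x)^-1 *: x).
Proof.
move=> x0 xs; have n0 : norm2 x != 0 by rewrite norm2_eq0.
split; first by rewrite norm2Z ger0_norm ?invr_ge0 ?norm2_ge0// mulVf.
apply: leq_trans xs; apply/subset_leq_card/fintype.subsetP => i.
by rewrite !inE mxE mulf_eq0 invr_eq0 (negPf n0).
Qed.

(** Where [v] vanishes, so does [w]; hence the whole span of [v] and [w] stays within the support of
    [v]. *)
Lemma norm0_le_lin s v w (a b : R) : supp v = supp w -> (norm0 v <= s)%N ->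
  (norm0 (a *: v + b *: w)%R <= s)%N.
Proof.
move=> vw; apply: leq_trans; apply/subset_leq_card/fintype.subsetP => i.
have := vw; move=> /setP/(_ i); rewrite !inE !mxE => vwi.
apply: contraNneq => v0; move: vwi; rewrite v0 eqxx => /esym/negbFE/eqP ->.
by rewrite !mulr0 addr0.
Qed.

(** * Extremal values over the sparse sphere *)

Section Sparse.
Variables (s : nat) (Sigma : 'M[R]_d).
Hypothesis pS : posdefmx Sigma.

Lemma qform_gt0 x : sparse_sphere s x -> 0 < qform Sigma x.
Proof.
move=> [x1 _]; apply: pS.2.
by rewrite -norm2_eq0 x1 oner_eq0.
Qed.

Lemma lambda_min_le x : sparse_sphere s x -> lambda_min s Sigma <= qform Sigma x.
Proof.
move=> xs; apply: ge_inf; last by exists x.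
by exists 0 => _ [y _ <-]; exact: posdef_ge0.
Qed.

(** Pointwise positivity does not bound an infimum away from 0. The uniform constant of
    [norm2_le_qform] does, with [c^-1] as lower bound, and replaces a compactness argument. *)
Lemma lambda_min_gt0 x : sparse_sphere s x -> 0 < lambda_min s Sigma.
Proof.
move=> xs; have [c c0 hc] := norm2_le_qform Sigma pS.
have hc1 y : sparse_sphere s y -> 1 <= c * qform Sigma y.
  by move=> [y1 _]; rewrite -[leLHS](expr1n _ 2) -y1.
have {}c0 : 0 < c.
  rewrite lt_neqAle c0 andbT; apply: contraTneq (hc1 x xs) => <-.
  by rewrite mul0r -ltNge ltr01.
apply: (@lt_le_trans _ _ c^-1); first by rewrite invr_gt0.
apply: lb_le_inf; first by exists (qform Sigma x), x.
by move=> _ [y /hc1 ys <-]; rewrite -(ler_pM2l c0) mulfV// gt_eqF.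
Qed.

Lemma qform_le_lambda_max x : (norm0 x <= s)%N ->
  qform Sigma x <= lambda_max s Sigma * norm2 x ^+ 2.
Proof.
have [->|x0 xs] := eqVneq x 0.
  have /eqP -> : norm2 (0 : 'cV[R]_d) == 0 by rewrite norm2_eq0.
  by rewrite qform0 expr0n mulr0.
have n0 : 0 < norm2 x by rewrite lt_def norm2_eq0 x0 norm2_ge0.
rewrite -ler_pdivrMr ?exprn_gt0// mulrC -exprVn -qformZ.
apply: ub_le_sup; last by exists ((norm2 x)^-1 *: x) => //; exact: normalize_sparse.
exists (\sum_i \sum_j `|Sigma j i|) => _ [y [y1 _] <-].
by rewrite (le_trans (ler_norm _))// qform_le_sum.
Qed.

Lemma qform_normalizeS (M : 'M[R]_d) x :
  qform M (normalizeS Sigma x) = qform M x / qform Sigma x.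
Proof. by rewrite qformZ exprVn sqr_sqrtr 1?mulrC// posdef_ge0. Qed.

Definition sup_ratio (M : 'M[R]_d) : R :=
  sup [set `|qform M (normalizeS Sigma u)| | u in sparse_sphere s]%classic.

Lemma ratio_le_sup (M : 'M[R]_d) x : sparse_sphere s x ->
  `|qform M x| / qform Sigma x <= sup_ratio M.
Proof.
move=> xs; apply: ub_le_sup; last first.
  exists x => //; rewrite qform_normalizeS normrM normfV.
  by rewrite (ger0_norm (posdef_ge0 _ _ pS)).
(* The numerator is bounded entrywise and the denominator from below by the positive
   [lambda_min]. *)
exists ((\sum_i \sum_j `|M j i|) / lambda_min s Sigma) => _ [y ys <-].
rewrite qform_normalizeS normrM normfV (ger0_norm (posdef_ge0 _ _ pS)).
apply: ler_pM; rewrite ?invr_ge0 ?posdef_ge0//.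
  by rewrite qform_le_sum//; case: ys.
by rewrite lef_pV2 ?posrE ?lambda_min_le ?qform_gt0// (lambda_min_gt0 _ ys).
Qed.

Lemma qform_le_sup (M : 'M[R]_d) x : (norm0 x <= s)%N ->
  `|qform M x| <= sup_ratio M * qform Sigma x.
Proof.
have [-> _|x0 xs] := eqVneq x 0; first by rewrite !qform0 mulr0 normr0.
have n0 : norm2 x != 0 by rewrite norm2_eq0.
have := ratio_le_sup M _ (normalize_sparse _ _ x0 xs).
rewrite !qformZ normrM normrX normfV (ger0_norm (norm2_ge0 _)).
rewrite -mulf_div divff ?expf_neq0 ?invr_eq0// mul1r.
by rewrite ler_pdivrMr// pS.2.
Qed.

Lemma bform_sqr_le_sup (M : 'M[R]_d) x y : M \is symmetricmx ->
    0 <= sup_ratio M ->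
    (forall a b, norm0 (a *: x + b *: y)%R <= s)%N ->
  bform M x y ^+ 2 <= sup_ratio M ^+ 2 * (qform Sigma x * qform Sigma y).
Proof.
(* The bound is split as [(S Q x) (S Q y)] to serve as [p * q] in [discriminant_le]. *)
move=> sM S0 xys; rewrite expr2 mulrACA.
apply: discriminant_le => [|t]; first by rewrite mulr_ge0// posdef_ge0.
(* The upper bound at [x + t y] minus the lower bound at [x - t y] gives
   [4 t B(x, y) <= 2 S (Q x + t^2 Q y)], the cross terms of [Sigma] cancelling. *)
have := qform_le_sup M _ (xys 1 (- t)); have := qform_le_sup M _ (xys 1 t).
rewrite !ler_norml => /andP[_ h1] /andP[h2 _]; move: h1 h2.
have [sS _] := pS; rewrite !qform_lin//.
by move=> h1 h2; lra.
Qed.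

End Sparse.

Lemma normalizeS_lagrange Sigma x y : posdefmx Sigma ->
    0 < qform Sigma x -> 0 < qform Sigma y ->
  qform Sigma (normalizeS Sigma x - normalizeS Sigma y)
    * qform Sigma (normalizeS Sigma x + normalizeS Sigma y)
  <= 4 * qform Sigma (x - y) / qform Sigma y.
Proof.
move=> [sS _] x0 y0.
have -> : x - y = 1 *: x + (- 1) *: y by rewrite scale1r scaleN1r.
rewrite /normalizeS -scaleNr !qform_lin// -subr_ge0.
have p0 : 0 < normS Sigma x by rewrite sqrtr_gt0.
have q0 : 0 < normS Sigma y by rewrite sqrtr_gt0.
have -> : qform Sigma x = normS Sigma x ^+ 2 by rewrite sqr_sqrtr// ltW.
have -> : qform Sigma y = normS Sigma y ^+ 2 by rewrite sqr_sqrtr// ltW.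
move: (normS _ x) (normS _ y) (bform _ x y) p0 q0 => p q r p0 q0.
(* Here [p], [q] are the [Sigma]-norms of [x], [y] and [r] is their [Sigma]-product; right side
   minus left side is a perfect square. *)
set D := (X in 0 <= X).
have -> : D = 4 * ((p ^+ 2 - r) / (p * q)) ^+ 2.
  by rewrite /D; field; rewrite !gt_eqF.
by rewrite mulr_ge0// sqr_ge0.
Qed.

End BilinearForm.

Theorem lemma2p2 (R : realType) (d s : nat) (hs : (1 <= s <= d)%N)
    (v w : 'cV[R]_d) (hv : sparse_sphere s v) (hw : sparse_sphere s w)
    (hsupp : supp v = supp w)
    (Sigma : 'M[R]_d) (hSigma : posdefmx Sigma)
    (M : 'M[R]_d) (hM : M \is symmetricmx) :
  `| `|qform M (normalizeS Sigma v)| - `|qform M (normalizeS Sigma w)| |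
    <= 2 * gamma s Sigma * norm2 (v - w)
       * sup [set `|qform M (normalizeS Sigma u)| | u in sparse_sphere s]%classic.
Proof.
rewrite -/(sup_ratio s Sigma M); set S := sup_ratio s Sigma M.
have Qv := qform_gt0 _ _ hSigma _ hv; have Qw := qform_gt0 _ _ hSigma _ hw.
have lmin := lambda_min_gt0 _ _ hSigma _ hw.
have S0 : 0 <= S.
  by apply: le_trans (ratio_le_sup _ _ hSigma M _ hv); rewrite divr_ge0// ltW.
have lin a b : (norm0 (a *: v + b *: w)%R <= s)%N.
  by apply: norm0_le_lin hsupp _; case: hv.
have lmax : 0 <= lambda_max s Sigma.
  have := qform_le_lambda_max s Sigma v hv.2.
  by rewrite hv.1 expr1n mulr1; apply/le_trans/ltW.
apply: (le_trans (ler_dist_dist _ _)).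
set a := normalizeS Sigma v; set b := normalizeS Sigma w.
rewrite qform_subr//.
(* Combinations of [a - b] and [a + b] are again combinations of [v] and [w]. *)
have linab x y : (norm0 (x *: (a - b) + y *: (a + b))%R <= s)%N.
  by rewrite scalerBr scalerDr addrACA !scalerA -scaleNr -!scalerDl.
have bound := bform_sqr_le_sup _ _ hSigma _ _ _ hM S0 linab.
have lag := normalizeS_lagrange _ _ _ hSigma Qv Qw.
have Qvw : qform Sigma (v - w) / qform Sigma w
    <= gamma s Sigma ^+ 2 * norm2 (v - w) ^+ 2.
  rewrite sqr_sqrtr ?divr_ge0 ?(ltW lmin)// mulrAC.
  apply: ler_pM; rewrite ?invr_ge0 ?(ltW Qw) ?posdef_ge0//.
    apply: qform_le_lambda_max.
    by have := lin 1 (- 1); rewrite scale1r scaleN1r.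
  by rewrite lef_pV2 ?posrE// lambda_min_le.
(* Both sides being nonnegative, their squares are compared; the 4 from [lag] is matched by the
   square of the constant 2. *)
rewrite -(ger0_norm (_ : 0 <= _ * S)) ?mulr_ge0 ?sqrtr_ge0//.
rewrite -ler_sqr ?nnegrE// -!normrX !ger0_norm ?sqr_ge0//.
apply: le_trans bound _; rewrite exprMn mulrC ler_wpM2r ?sqr_ge0//.
apply: le_trans lag _; rewrite -mulrA !exprMn -mulrA.
by rewrite -natrX ler_pM2l.
Qed.
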